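(* Let $d\in\mathbb{N}$. The ring $\mathcal{S}'(\mathbb{Z}^d)$ is not a projective free ring.
   Context: $\mathbb{N}=\{1,2,3,\dots\}$. For $\mathbf{n}=(n_1,\dots,n_d)\in\mathbb{Z}^d$ write $|\mathbf{n}|_1:=|n_1|+\cdots+|n_d|$. The set $\mathcal{S}'(\mathbb{Z}^d)$ consists of all maps $\mathbf{a}:\mathbb{Z}^d\to\mathbb{C}$ of at most polynomial growth, i.e. such that there exist a real $M>0$ and $k\in\mathbb{N}$ with $|\mathbf{a}(\mathbf{n})|\le M(1+|\mathbf{n}|_1)^k$ for all $\mathbf{n}\in\mathbb{Z}^d$. With pointwise addition and multiplication it is a commutative unital ring. A commutative unital ring $R$ is projective free if every finitely generated projective $R$-module is free. *)

(* Defs.v *)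
From HB Require Import structures.
From mathcomp Require Import all_boot all_order all_algebra.
From mathcomp Require Import boolp classical_sets functions reals.
From mathcomp Require Export complex.

Set Implicit Arguments.
Unset Strict Implicit.
Unset Printing Implicit Defensive.

Import Order.TTheory GRing.Theory Num.Theory.
Local Open Scope ring_scope.
Local Open Scope complex_scope.

Section Modules.
Variable R : comPzRingType.

Definition finitely_generated (M : lmodType R) : Prop :=
  exists (n : nat) (v : 'I_n -> M),
    forall x : M, exists c : 'I_n -> R, x = \sum_(i < n) c i *: v i.

Definition linearly_independent (M : lmodType R) (I : eqType) (b : I -> M) :
    Prop :=
  forall (s : seq I) (c : I -> R), uniq s ->
    \sum_(i <- s) c i *: b i = 0 -> forall i, i \in s -> c i = 0.

Definition spanning (M : lmodType R) (I : eqType) (b : I -> M) : Prop :=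
  forall x : M, exists (s : seq I) (c : I -> R), x = \sum_(i <- s) c i *: b i.

(* The basis may be infinite; only finite linear combinations are used. *)
Definition free_module (M : lmodType R) : Prop :=
  exists (I : eqType) (b : I -> M), linearly_independent b /\ spanning b.

Definition projective_module (M : lmodType R) : Prop :=
  forall (N P : lmodType R) (f : {linear N -> P}) (g : {linear M -> P}),
    (forall y : P, exists x : N, f x = y) ->
    exists h : {linear M -> N}, forall x : M, f (h x) = g x.

End Modules.

Definition projective_free (R : comPzRingType) : Prop :=
  forall M : lmodType R,
    finitely_generated M -> projective_module M -> free_module M.

Definition norm1 (d : nat) (n : 'rV[int]_d) : nat :=
  (\sum_(i < d) absz (n ord0 i))%N.

Section PolynomialGrowth.
Variables (R : realType) (d : nat).

Definition polynomial_growth (a : 'rV[int]_d -> R[i]) : Prop :=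
  exists (M : R) (k : nat), [/\ 0 < M, (0 < k)%N &
    forall n : 'rV[int]_d, `|a n| <= (M * (1 + (norm1 n)%:R) ^+ k)%:C].

Definition tempered : {pred 'rV[int]_d -> R[i]} :=
  fun a => `[< polynomial_growth a >].

Lemma tempered_subring_closed : subring_closed tempered.
Proof.
have weight1 (n : 'rV[int]_d) : 1 <= 1 + (norm1 n)%:R :> R.
  by rewrite lerDl ler0n.
have weight0 (n : 'rV[int]_d) k : 0 <= (1 + (norm1 n)%:R) ^+ k :> R.
  by rewrite exprn_ge0 // addr_ge0 ?ler0n.
split.
- apply/asboolP; exists 1, 1%N; split=> // n.
  by rewrite normr1 mul1r expr1 -[1]/(1%:C) lecR.
- move=> a b /asboolP[M [k [M0 k0 Ma]]] /asboolP[N [l [N0 l0 Nb]]].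
  apply/asboolP; exists (M + N), (k + l)%N; split.
  + by rewrite addr_gt0.
  + by rewrite addn_gt0 k0.
  + move=> n; apply: le_trans (ler_normB _ _) _.
    apply: le_trans (lerD (Ma n) (Nb n)) _.
    rewrite -rmorphD lecR mulrDl lerD //.
      by rewrite ler_wpM2l ?(ltW M0) // ler_weXn2l // leq_addr.
    by rewrite ler_wpM2l ?(ltW N0) // ler_weXn2l // leq_addl.
- move=> a b /asboolP[M [k [M0 k0 Ma]]] /asboolP[N [l [N0 l0 Nb]]].
  apply/asboolP; exists (M * N), (k + l)%N; split.
  + by rewrite mulr_gt0.
  + by rewrite addn_gt0 k0.
  + move=> n; rewrite normrM exprD mulrACA rmorphM /=.
    by apply: ler_pM (Ma n) (Nb n).
Qed.

(* S'(Z^d), as a subring of the functions Z^d -> C with their pointwise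
   operations. *)
Record tempered_seq := TemperedSeq {
  tempered_val :> 'rV[int]_d -> R[i];
  _ : tempered_val \in tempered }.

HB.instance Definition _ := [isSub for tempered_val].
HB.instance Definition _ := [Choice of tempered_seq by <:].
HB.instance Definition _ :=
  GRing.SubChoice_isSubComPzRing.Build _ _ tempered_seq
    tempered_subring_closed.

End PolynomialGrowth.

Arguments tempered_seq : clear implicits.

(* Main.v *)
(** A ring with an idempotent [e] other than 0 and 1 is not projective free: the
    ideal generated by [e] is a direct summand of the ring, but it is killed by
    [1 - e], so it contains no linearly independent element, although it is
    nonzero.  The ring of tempered sequences contains such an idempotent, the
    indicator function of the origin. *)
Require Import Defs.
From HB Require Import structures.
From mathcomp Require Import all_boot all_order all_algebra.
From mathcomp Require Import boolp reals.

Import Order.TTheory GRing.Theory Num.Theory.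
Local Open Scope ring_scope.

Section FixedIdeal.
Variables (A : comPzRingType) (e : A).

(* For idempotent [e] this is the principal ideal [e A]. *)
Definition fixed_by : {pred A^o} := fun x => e * x == x.

Lemma fixed_by_submod_closed : submod_closed fixed_by.
Proof.
split=> [|a x y]; rewrite !unfold_in ?mulr0 // => /eqP ex /eqP ey.
by rewrite /GRing.scale /= mulrDr mulrCA ex ey.
Qed.

HB.instance Definition _ :=
  GRing.isSubmodClosed.Build A A^o fixed_by fixed_by_submod_closed.

Record fixed_ideal := FixedIdeal { fixed_val : A^o; _ : fixed_val \in fixed_by }.

HB.instance Definition _ := [isSub for fixed_val].
HB.instance Definition _ := [Choice of fixed_ideal by <:].
HB.instance Definition _ := [SubChoice_isSubLmodule of fixed_ideal by <:].

Lemma fixed_idealP (x : fixed_ideal) : e * val x = val x.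
Proof. exact/eqP/(valP x). Qed.

Hypothesis idem_e : e * e = e.

Lemma idempotent_fixed : (e : A^o) \in fixed_by.
Proof. by rewrite unfold_in idem_e. Qed.

Definition fixed_gen : fixed_ideal := FixedIdeal _ idempotent_fixed.

(** Since [e * x = x] on the ideal, [x] itself, read as a scalar, serves as its coefficient on
    [e]. *)
Lemma fixed_ideal_genE (x : fixed_ideal) : x = (val x : A) *: fixed_gen.
Proof.
by apply: val_inj; rewrite linearZ /= /GRing.scale /= mulrC fixed_idealP.
Qed.

Lemma fixed_ideal_fg : finitely_generated fixed_ideal.
Proof.
exists 1%N, (fun=> fixed_gen) => x.
by exists (fun=> val x); rewrite big_ord1 -fixed_ideal_genE.
Qed.

(** It suffices to lift the image of the generator: if [f n = g e], then [x] is sent to [x *: n],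
    and [f (x *: n) = x *: g e = g (x *: e) = g x]. *)
Lemma fixed_ideal_projective : projective_module fixed_ideal.
Proof.
move=> N P f g /(_ (g fixed_gen))[n fn].
pose h (x : fixed_ideal) : N := (val x : A) *: n.
have lin_h : linear h.
  by move=> a x y; rewrite /h linearP /= scalerDl scalerA.
pose hL := GRing.isLinear.Build _ _ _ _ h lin_h.
pose H : {linear fixed_ideal -> N} := HB.pack h hL.
exists H => x; rewrite /= /h linearZ fn -linearZ /=.
by rewrite -fixed_ideal_genE.
Qed.

Lemma fixed_ideal_not_free : e != 0 -> e != 1 -> ~ free_module fixed_ideal.
Proof.
move=> e0 e1 [I [b [lin_b span_b]]].
have killed (i : I) : (1 - e) *: b i = 0.
  apply: val_inj; rewrite linearZ /= /GRing.scale /= mulrBl mul1r.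
  by rewrite fixed_idealP subrr.
(* Independence of the single vector [b i] turns [killed] into [1 - e = 0], so [I] must be empty. *)
have noI (i : I) : False.
  have := lin_b [:: i] (fun=> 1 - e) isT.
  rewrite big_seq1 => /(_ (killed i) i (mem_head _ _)) /eqP.
  by rewrite subr_eq0 eq_sym (negPf e1).
(* Only the empty combination remains to express [e], which forces [e = 0]. *)
have [[|i s] [c]] := span_b fixed_gen; last by case: (noI i).
rewrite big_nil => /(congr1 val) /= /eqP.
by rewrite (negPf e0).
Qed.

End FixedIdeal.

Lemma idempotent_not_projective_free (A : comPzRingType) (e : A) :
  e * e = e -> e != 0 -> e != 1 -> ~ projective_free A.
Proof.
move=> ee e0 e1 /(_ (fixed_ideal A e)) free.
apply: (fixed_ideal_not_free A e ee e0 e1).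
by apply: free; [exact: fixed_ideal_fg | exact: fixed_ideal_projective].
Qed.

Section OriginIndicator.
Variables (R : realType) (d : nat).

Definition origin_fun (n : 'rV[int]_d) : R[i] := (n == 0)%:R.

Lemma origin_fun_tempered : origin_fun \in @tempered R d.
Proof.
(* The values are 0 or 1, hence at most [1 + norm1 n]; the comparison is moved from [R[i]] to
   [R]. *)
apply/asboolP; exists 1, 1%N; split=> // n.
rewrite mul1r expr1 -[X in X <= _](_ : (n == 0)%:R = _).
  rewrite -(rmorph_nat (real_complex R)) lecR.
  by apply: (@le_trans _ _ 1); rewrite ?lern1 ?leq_b1 // lerDl ler0n.
by rewrite normr_nat.
Qed.

Definition origin_seq : tempered_seq R d := TemperedSeq origin_fun_tempered.

End OriginIndicator.

Theorem theorem6p2 (R : realType) (d : nat) (hd : (0 < d)%N) :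
  ~ projective_free (tempered_seq R d).
Proof.
apply: (@idempotent_not_projective_free _ (origin_seq R d)).
- apply: val_inj; rewrite rmorphM /=; apply/funext => n.
  by rewrite /origin_fun /GRing.mul /= -natrM mulnb andbb.
- apply/eqP => /(congr1 val); rewrite rmorph0 /= => /(congr1 (@^~ 0)).
  by move/eqP; rewrite /origin_fun eqxx oner_eq0.
- apply/eqP => /(congr1 val); rewrite rmorph1 /=.
  (* The all-ones point is not the origin, because [hd] supplies a coordinate; the indicator
     vanishes there, while the unit takes the value 1. *)
  move=> /(congr1 (@^~ (const_mx 1))) /eqP.
  have -> : origin_fun R d (const_mx 1) = 0.
    rewrite /origin_fun; case: eqP => // /matrixP /(_ ord0 (Ordinal hd)).
    by rewrite !mxE.
  by rewrite eq_sym oner_eq0.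
Qed.
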